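(* Let $\mathcal F$ be a division ring with an involutive anti-automorphism $*$ and of characteristic different from $2$. Let $A\in\mathcal F^{m\times p}$, $B\in\mathcal F^{m\times q}$, $C\in\mathcal F^{s\times p}$, $D\in\mathcal F^{p\times t}$, $\Phi=\Phi^*\in\mathcal F^{m\times m}$, $\Omega\in\mathcal F^{s\times t}$ be given. The system of matrix equations $$AXA^*+BY+(BY)^*=\Phi,\qquad CXD=\Omega,\qquad X=X^*$$ has a solution $(X,Y)\in\mathcal F^{p\times p}\times\mathcal F^{q\times m}$ if and only if all of the following rank equalities hold: $$\mathrm{r}\begin{pmatrix}\Phi&A&B\\ B^*&0&0\end{pmatrix}=\mathrm{r}(A,B)+\mathrm{r}(B),\quad \mathrm{r}(C,\Omega)=\mathrm{r}(C),\quad \mathrm{r}\begin{pmatrix}D\\ \Omega\end{pmatrix}=\mathrm{r}(D),$$ $$\mathrm{r}\begin{pmatrix}\Phi&0&A&B\\ 0&-\Omega&C&0\\ A^*&D&0&0\\ B^*&0&0&0\end{pmatrix}=\mathrm{r}\begin{pmatrix}A&B\\ C&0\end{pmatrix}+\mathrm{r}\begin{pmatrix}A&B\\ D^*&0\end{pmatrix},$$ $$\mathrm{r}\begin{pmatrix}\Omega&0&C\\ 0&-\Omega^*&D^*\\ D&C^*&0\end{pmatrix}=2\,\mathrm{r}\begin{pmatrix}C\\ D^*\end{pmatrix},$$ $$\mathrm{r}\begin{pmatrix}\Phi&0&0&A&A&B\\ 0&-\Omega&0&C&0&0\\ 0&0&-\Omega^*&0&D^*&0\\ A^*&D&C^*&0&0&0\\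 B^*&0&0&0&0&0\end{pmatrix}=\mathrm{r}\begin{pmatrix}A&A&B\\ C&0&0\\ 0&D^*&0\end{pmatrix}+\mathrm{r}\begin{pmatrix}A&B\\ C&0\\ D^*&0\end{pmatrix}.$$
   Context: $\mathcal F^{m\times n}$ is the set of $m\times n$ matrices over $\mathcal F$. For a matrix $A$ over $\mathcal F$, $A^*$ is its conjugate transpose: the transpose with the involutive anti-automorphism $*$ of $\mathcal F$ applied to each entry. The rank $\mathrm{r}(\cdot)$ of a matrix over $\mathcal F$ is the dimension of its left row space, equal to the dimension of its right column space. Blocks $0$ denote zero blocks of the appropriate size. *)

(* Defs.v *)
From mathcomp Require Import all_boot all_order all_algebra.
From mathcomp Require Import boolp classical_sets.
Set Implicit Arguments.
Unset Strict Implicit.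
Unset Printing Implicit Defensive.
Import GRing.Theory.
Local Open Scope classical_set_scope.
Local Open Scope ring_scope.

(* Division rings are unitRingTypes satisfying GRing.field_axiom, which only
   says that nonzero elements are units.  In particular \rank, which requires
   a (commutative) fieldType, is not available, whence mxrank_div below.
   The conjugate transpose of M is the library's M ^t star, i.e.
   map_mx star M^T. *)

(* star 1 = 1 follows from these three conditions. *)
Record involutive_antiautomorphism (F : nzRingType) (star : F -> F) : Prop := {
  star_add : forall x y, star (x + y) = star x + star y;
  star_mul : forall x y, star (x * y) = star y * star x;
  star_inv : involutive star }.

Section LeftRowRank.
Variable F : unitRingType.

Definition left_row_space m n (A : 'M[F]_(m, n)) : set 'rV[F]_n :=
  range (fun u : 'rV[F]_m => u *m A).

Definition left_free k n (B : 'M[F]_(k, n)) : Prop :=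
  forall u : 'rV[F]_k, u *m B = 0 -> u = 0.

(* The rows of B form a basis of the left subspace V of F^n. *)
Definition left_basis n (V : set 'rV[F]_n) k (B : 'M[F]_(k, n)) : Prop :=
  left_free B /\ left_row_space B = V.

(* The default value 0 is never used over a division ring, and the value does
   not depend on a choice of basis: see mxrank_divP. *)
Definition left_dim n (V : set 'rV[F]_n) : nat :=
  xget 0%N [set k | exists B : 'M[F]_(k, n), left_basis V B].

Definition mxrank_div m n (A : 'M[F]_(m, n)) : nat :=
  left_dim (left_row_space A).

Hypothesis divF : GRing.field_axiom F.

Lemma left_free_leq k n (B : 'M[F]_(k, n)) : left_free B -> (k <= n)%N.
Proof.
elim: n k B => [|n IHn] [|k] B // freeB.
  have /rowP/(_ ord0)/eqP := freeB (const_mx 1) (thinmx0 _).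
  by rewrite !mxE oner_eq0.
have [/existsP[i Bi0]|/existsPn B0] := boolP [exists i, B i ord0 != 0].
- have Bu := divF Bi0.
  pose C : 'M[F]_(k, n) :=
    \matrix_(j, l) (B (lift i j) (lift ord0 l) -
       B (lift i j) ord0 * (B i ord0)^-1 * B i (lift ord0 l)).
  rewrite ltnS; apply: (IHn k C) => u uC0.
  pose a := - (\sum_j u 0 j * B (lift i j) ord0) * (B i ord0)^-1.
  pose v : 'rV[F]_k.+1 :=
    \row_j (if unlift i j is Some l then u 0 l else a).
  have vE (l : 'I_n.+1) : (v *m B) 0 l =
      a * B i l + \sum_j u 0 j * B (lift i j) l.
    rewrite mxE (bigD1_ord i) //= mxE unlift_none; congr (_ + _).
    by apply: eq_bigr => j _; rewrite mxE liftK.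
  have v0 : v = 0.
    apply: freeB; apply/rowP => l; rewrite vE mxE.
    case: (unliftP ord0 l) => [l'|] ->.
      have /rowP/(_ l') := uC0; rewrite !mxE => uC.
      rewrite -[RHS]uC addrC /a !mulNr -mulrA mulr_suml -sumrB.
      by apply: eq_bigr => j _; rewrite mxE mulrBr !mulrA.
    by rewrite /a mulrVK // addNr.
  apply/rowP => j; have /rowP/(_ (lift i j)) := v0.
  by rewrite !mxE liftK.
- apply: leqW; apply: (IHn k.+1 (\matrix_(j, l) B j (lift ord0 l))) => u u0.
  apply: freeB; apply/rowP => l; rewrite !mxE.
  case: (unliftP ord0 l) => [l'|] ->.
    have /rowP/(_ l') := u0; rewrite !mxE => uC.
    by rewrite -[RHS]uC; apply: eq_bigr => j _; rewrite mxE.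
  rewrite big1 // => j _.
  by have /negPn/eqP -> := B0 j; rewrite mulr0.
Qed.

Lemma left_row_spaceP m k n (A : 'M[F]_(m, n)) (B : 'M[F]_(k, n)) :
  left_row_space A `<=` left_row_space B -> exists P, A = P *m B.
Proof.
move=> sAB; have rP i : exists u : 'rV_k, u *m B = row i A.
  have [|u _ uB] := sAB (row i A); last by exists u.
  by exists (delta_mx 0 i) => //; rewrite -rowE.
have [f fP] := choice rP.
exists (\matrix_i f i); apply/row_matrixP => i.
by rewrite row_mul rowK fP.
Qed.

Lemma left_basis_leq n (V : set 'rV[F]_n) k l (B : 'M_(k, n)) (C : 'M_(l, n)) :
  left_basis V B -> left_basis V C -> (k <= l)%N.
Proof.
move=> [freeB <-] [_ eqCB].
have [|P BE] := @left_row_spaceP _ _ _ B C; first by rewrite eqCB.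
apply: (@left_free_leq _ _ P) => u uP.
by apply: freeB; rewrite BE mulmxA uP mul0mx.
Qed.

Lemma left_basis_exists m n (A : 'M[F]_(m, n)) :
  exists k (B : 'M[F]_(k, n)), left_basis (left_row_space A) B.
Proof.
elim: m A => [|m IHm] A.
  by exists 0%N, A; split=> // u _; rewrite [u]thinmx0.
rewrite -[A](@vsubmxK _ 1 m); set a := usubmx _; set A' := dsubmx _.
have [k [B [freeB BA]]] := IHm A'.
have [[w _ wA]|naA] := pselect (left_row_space A' a).
  exists k, B; split=> //; rewrite BA; apply/seteqP; split=> x [u _ <-].
    by exists (row_mx (0 : 'rV_1) u) => //;
       rewrite (@mul_row_col _ _ 1) mul0mx add0r.
  exists (lsubmx (u : 'rV_(1 + m)) *m w + rsubmx (u : 'rV_(1 + m))) => //.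
  by rewrite mulmxDl -mulmxA wA -(@mul_row_col _ _ 1) hsubmxK.
exists (1 + k)%N, (col_mx a B); split.
  move=> u; rewrite -[u]hsubmxK mul_row_col.
  set x := lsubmx u; set y := rsubmx u => xy0.
  have x0 : x = 0.
    have [x00|/divF xu] := eqVneq (x 0 0) 0.
      by rewrite [x]mx11_scalar x00 -scalemx1 scale0r.
    case: naA; rewrite -BA; exists (- (x 0 0)^-1 *: y) => //.
    rewrite -scalemxAl scaleNr.
    have -> : y *m B = - (x *m a) by apply/eqP; rewrite -addr_eq0 addrC xy0.
    by rewrite scalerN opprK [x]mx11_scalar mul_scalar_mx mxE eqxx mulr1n
               scalerA mulVr // scale1r.
  move: xy0; rewrite x0 mul0mx add0r => /freeB ->.
  by rewrite row_mx0.
apply/seteqP; split=> x [u _ <-].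
  have : left_row_space A' (rsubmx (u : 'rV_(1 + k)) *m B).
    by rewrite -BA; exists (rsubmx (u : 'rV_(1 + k))).
  case=> w _ wE; exists (row_mx (lsubmx (u : 'rV_(1 + k))) w) => //.
  by rewrite (@mul_row_col _ _ 1) wE -(@mul_row_col _ _ 1) hsubmxK.
have : left_row_space B (rsubmx (u : 'rV_(1 + m)) *m A').
  by rewrite BA; exists (rsubmx (u : 'rV_(1 + m))).
case=> w _ wE; exists (row_mx (lsubmx (u : 'rV_(1 + m))) w) => //.
by rewrite (@mul_row_col _ _ 1) wE -(@mul_row_col _ _ 1) hsubmxK.
Qed.

Lemma mxrank_divP m n (A : 'M[F]_(m, n)) k :
  mxrank_div A = k <->
  exists B : 'M[F]_(k, n), left_basis (left_row_space A) B.
Proof.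
have [l Bl] := left_basis_exists A.
have rP : exists B : 'M[F]_(mxrank_div A, n), left_basis (left_row_space A) B.
  exact: (xgetI 0%N (Bl : [set r | exists B : 'M[F]_(r, n),
                             left_basis (left_row_space A) B] l)).
split=> [<- //|[B hB]]; have [C hC] := rP.
by apply/eqP; rewrite eqn_leq (left_basis_leq hB hC) (left_basis_leq hC hB).
Qed.

End LeftRowRank.

(* Main.v *)
(* Since 2 is invertible, A X A^* + B Y + (B Y)^* = Phi is solvable in Y for a
   given Hermitian X as soon as Q (Phi - A X A^* ) Q^* = 0, where Q is the left
   annihilator of B, and any common solution X of
     (Q A) X (Q A)^* = Q Phi Q^*,  C X D = Omega,  D^* X C^* = Omega^*
   may be replaced by its Hermitian part.  So the problem is when three
   equations A_i X B_i = C_i have a common solution.  Reading X as a bilinear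
   form on rows and columns prescribed on (rows of A_i) x (columns of B_i), the
   obstructions are the linear relations among these products: those between two
   of the products, and those pairing an element common to the three row spaces
   with a relation among the three column spaces, or conversely.  Each rank
   equality r(M N; K 0) = r(N) + r(K) says that x M v = 0 whenever x N = 0 and
   K v = 0, and the six given ones spell out exactly these obstructions, up to
   the symmetry given by the conjugate transpose. *)

Require Import Defs.
From mathcomp Require Import all_boot all_order all_algebra.
From mathcomp Require Import boolp classical_sets.
Set Implicit Arguments.
Unset Strict Implicit.
Unset Printing Implicit Defensive.
Import GRing.Theory.
Local Open Scope ring_scope.
Local Open Scope sesquilinear_scope.

(** * Conjugate transposition of matrices *)

Section ConjugateTranspose.
Variables (F : unitRingType) (star : F -> F).
Hypothesis starP : involutive_antiautomorphism star.

Lemma star0 : star 0 = 0.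
Proof. by apply: (addrI (star 0)); rewrite -(star_add starP) !addr0. Qed.

Lemma star1 : star 1 = 1.
Proof.
by rewrite -[star 1]mulr1 -{2}[1](star_inv starP) -(star_mul starP) mulr1 (star_inv starP).
Qed.

Lemma starN x : star (- x) = - star x.
Proof. by apply: (addrI (star x)); rewrite -(star_add starP) !subrr star0. Qed.

Lemma ctmxK m n (A : 'M[F]_(m, n)) : A ^t star ^t star = A.
Proof. by apply/matrixP => i j; rewrite !mxE (star_inv starP). Qed.

Lemma ctmx_inj m n (A B : 'M[F]_(m, n)) : A ^t star = B ^t star -> A = B.
Proof. by move=> eAB; rewrite -[A]ctmxK eAB ctmxK. Qed.

Lemma ctmxM m n k (A : 'M[F]_(m, n)) (B : 'M_(n, k)) :
  (A *m B) ^t star = B ^t star *m A ^t star.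
Proof.
apply/matrixP => i j; rewrite !mxE (big_morph _ (star_add starP) star0).
by apply: eq_bigr => l _; rewrite !mxE (star_mul starP).
Qed.

Lemma ctmxD m n (A B : 'M[F]_(m, n)) : (A + B) ^t star = A ^t star + B ^t star.
Proof. by apply/matrixP => i j; rewrite !mxE (star_add starP). Qed.

Lemma ctmxN m n (A : 'M[F]_(m, n)) : (- A) ^t star = - (A ^t star).
Proof. by apply/matrixP => i j; rewrite !mxE starN. Qed.

Lemma ctmx0 m n : (0 : 'M[F]_(m, n)) ^t star = 0.
Proof. by apply/matrixP => i j; rewrite !mxE star0. Qed.

Lemma ctmx1 n : (1%:M : 'M[F]_n) ^t star = 1%:M.
Proof.
by apply/matrixP => i j; rewrite !mxE eq_sym; case: (i == j); rewrite ?star1 ?star0.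
Qed.

Lemma ctmx_row m n1 n2 (A : 'M[F]_(m, n1)) (B : 'M_(m, n2)) :
  (row_mx A B) ^t star = col_mx (A ^t star) (B ^t star).
Proof. by rewrite tr_row_mx map_col_mx. Qed.

Lemma ctmx_col m1 m2 n (A : 'M[F]_(m1, n)) (B : 'M_(m2, n)) :
  (col_mx A B) ^t star = row_mx (A ^t star) (B ^t star).
Proof. by rewrite tr_col_mx map_row_mx. Qed.

End ConjugateTranspose.

(** * The scalar 1/2 *)

Section Half.
Variables (F : unitRingType) (star : F -> F).
Hypothesis divF : GRing.field_axiom F.
Hypothesis charF : 2%N \notin [pchar F].
Hypothesis starP : involutive_antiautomorphism star.

Let half : F := 2%:R^-1.

Lemma half_unit : (2%:R : F) \is a GRing.unit.
Proof. by apply: divF; move: charF; rewrite inE. Qed.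

(** The inverse of a natural number is central, which lets halving pass through products over the
    noncommutative [F]. *)
Lemma half_comm x : half * x = x * half.
Proof. by apply: commr_sym; apply: commrV; apply: commr_nat. Qed.

Lemma half_half : half + half = 1.
Proof. by rewrite -mulr2n -mulr_natr mulVr // half_unit. Qed.

Lemma star_half : star half = half.
Proof.
rewrite -[LHS]mulr1 -half_half mulrDr -mulrDl -(star_add starP) half_half.
by rewrite (star1 starP) mul1r.
Qed.

Lemma halfmxD m n (A : 'M[F]_(m, n)) : half *: A + half *: A = A.
Proof. by rewrite -scalerDl half_half scale1r. Qed.

Lemma mulmx_half m n k (A : 'M[F]_(m, n)) (B : 'M_(n, k)) :
  A *m (half *: B) = half *: (A *m B).
Proof.
apply/matrixP => i j; rewrite !mxE mulr_sumr; apply: eq_bigr => l _.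
by rewrite mxE mulrA -half_comm mulrA.
Qed.

Lemma ctmx_half m n (A : 'M[F]_(m, n)) :
  (half *: A) ^t star = half *: A ^t star.
Proof.
by apply/matrixP => i j; rewrite !mxE (star_mul starP) star_half half_comm.
Qed.

End Half.

(** * Full-rank factorization and its consequences for the rank *)

Section Rank.
Variables (F : unitRingType) (star : F -> F).
Hypothesis divF : GRing.field_axiom F.
Hypothesis starP : involutive_antiautomorphism star.
Local Notation rk := mxrank_div.

(** A row outside the row space of [B] could be stacked on [B] to give [k + 1] free rows of length
    [k], which [left_free_leq] forbids. *)
Lemma left_free_linv k (B : 'M[F]_k) : left_free B -> exists T, T *m B = 1%:M.
Proof.
move=> freeB.
have [|T BT] := @left_row_spaceP _ _ _ _ (1%:M : 'M[F]_k) B; last by exists T.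
move=> v _; apply: contrapT => nv.
suff /(left_free_leq divF) : left_free (col_mx v B) by rewrite add1n ltnn.
move=> u; rewrite -[u]hsubmxK mul_row_col.
set x := lsubmx u; set y := rsubmx u => xy0.
have x0 : x = 0.
  have [x00|/divF xu] := eqVneq (x 0 0) 0.
    by rewrite [x]mx11_scalar x00 -scalemx1 scale0r.
  case: nv; exists (- (x 0 0)^-1 *: y) => //.
  rewrite -scalemxAl scaleNr.
  have -> : y *m B = - (x *m v) by apply/eqP; rewrite -addr_eq0 addrC xy0.
  by rewrite scalerN opprK [x]mx11_scalar mul_scalar_mx mxE eqxx mulr1n
             scalerA mulVr // scale1r.
move: xy0; rewrite x0 mul0mx add0r => /freeB ->.
by rewrite row_mx0.
Qed.

Lemma left_basis_factor m n k (A : 'M[F]_(m, n)) (R : 'M_(k, n)) :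
  left_basis (left_row_space A) R ->
  (exists L, A = L *m R) /\ (exists S, R = S *m A).
Proof. by case=> _ eqRA; split; apply: left_row_spaceP; rewrite eqRA. Qed.

(* The column analogue of left_basis_exists is obtained by conjugate
   transposition instead of passing to the opposite ring. *)
Lemma left_free_rinv k n (R : 'M[F]_(k, n)) :
  left_free R -> exists R', R *m R' = 1%:M.
Proof.
move=> freeR; have [k' [B bB]] := left_basis_exists divF (R ^t star).
have [[P RE] [S BE]] := left_basis_factor bB.
have {RE}RE : R = B ^t star *m P ^t star by rewrite -(ctmxM starP) -RE (ctmxK starP).
have freeBs : left_free (B ^t star).
  by move=> u u0; apply: freeR; rewrite RE mulmxA u0 mul0mx.
have Ek : k' = k.
  by apply/eqP; rewrite eqn_leq (left_free_leq divF freeBs) (left_free_leq divF bB.1).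
move: B bB P S BE {RE freeBs}; rewrite {}Ek => B bB _ S BE.
have [T TB] := left_free_linv bB.1; exists (S ^t star *m T ^t star).
by rewrite mulmxA -{1}[R](ctmxK starP) -(ctmxM starP) -BE -(ctmxM starP) TB (ctmx1 starP).
Qed.

(** [R] is a basis of the row space of [A], and [S] expresses it through the rows of [A]. Hence
    [S *m L *m R = R], and cancelling [R] makes [S] a left inverse of [L]. *)
Lemma rank_factorization m n (A : 'M[F]_(m, n)) :
  exists k (L : 'M_(m, k)) (R : 'M_(k, n)) (L' : 'M_(k, m)) (R' : 'M_(n, k)),
  [/\ rk A = k, A = L *m R, L' *m L = 1%:M & R *m R' = 1%:M].
Proof.
have [R bR] := (mxrank_divP divF A (rk A)).1 erefl.
have [[L AE] [S RE]] := left_basis_factor bR.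
have [R' RR'] := left_free_rinv bR.1.
exists (rk A), L, R, S, R'; split=> //.
by rewrite -[S *m L]mulmx1 -RR' mulmxA -(mulmxA S) -AE -RE.
Qed.

Lemma factorization_rank m n k (L : 'M[F]_(m, k)) (R : 'M_(k, n)) L' R' :
  L' *m L = 1%:M -> R *m R' = 1%:M -> rk (L *m R) = k.
Proof.
move=> LL RR; apply/(mxrank_divP divF); exists R; split.
  by move=> u uR; rewrite -[u]mulmx1 -RR mulmxA uR mul0mx.
apply/seteqP; split=> _ [u _ <-].
  by exists (u *m L') => //; rewrite mulmxA -(mulmxA u) LL mulmx1.
by exists (u *m L) => //; rewrite mulmxA.
Qed.

(** Conjugate transposition swaps the factors of a full-rank factorization and keeps its inner
    size. *)
Lemma mxrank_div_ct m n (A : 'M[F]_(m, n)) : rk (A ^t star) = rk A.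
Proof.
have [k [L [R [L' [R' [-> AE LL RR]]]]]] := rank_factorization A.
rewrite {1}AE (ctmxM starP); apply: (@factorization_rank _ _ _ _ _ (R' ^t star) (L' ^t star)).
  by rewrite -(ctmxM starP) RR (ctmx1 starP).
by rewrite -(ctmxM starP) LL (ctmx1 starP).
Qed.

(** The matrix [L' *m P *m L2] has as many rows as the rank of the product and as many columns as
    the rank of [A]. A row killing it also kills [L' *m (P *m A *m Q) *m R'], which is the
    identity. *)
Lemma mxrank_div_mul m n m' n' (P : 'M[F]_(m, m')) (A : 'M_(m', n')) (Q : 'M_(n', n)) :
  (rk (P *m A *m Q) <= rk A)%N.
Proof.
have [k [L [R [L' [R' [-> PE LL RR]]]]]] := rank_factorization (P *m A *m Q).
have [l [L2 [R2 [_ [_ [-> AE _ _]]]]]] := rank_factorization A.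
apply: (left_free_leq divF (B := L' *m P *m L2)) => u u0.
have : u *m (L' *m (P *m A *m Q) *m R') = 0.
  by rewrite AE !mulmxA -(mulmxA u) -(mulmxA u) u0 !mul0mx.
by rewrite PE (mulmxA L') LL mul1mx RR mulmx1.
Qed.

Lemma mxrank_div_eq m n m' n' (A : 'M[F]_(m, n)) (B : 'M_(m', n')) P Q P' Q' :
  A = P *m B *m Q -> B = P' *m A *m Q' -> rk A = rk B.
Proof.
move=> AE BE; apply/eqP; rewrite eqn_leq; apply/andP; split.
  by rewrite AE mxrank_div_mul.
by rewrite BE mxrank_div_mul.
Qed.

Lemma mxrank_div_eq0 m n (A : 'M[F]_(m, n)) : rk A = 0%N -> A = 0.
Proof.
have [k [L [R [_ [_ [-> -> _ _]]]]]] := rank_factorization A.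
by move=> k0; move: L R; rewrite k0 => L R; rewrite [L]thinmx0 mul0mx.
Qed.

Lemma mxrank_div0 m n : rk (0 : 'M[F]_(m, n)) = 0%N.
Proof.
rewrite -(mul0mx _ (0 : 'M_(0, n))).
by apply: (@factorization_rank _ _ _ _ _ 0 0); apply/matrixP => -[].
Qed.

(** * Inner inverses, block matrices and annihilators *)

Lemma ginv m n (A : 'M[F]_(m, n)) : exists G, A *m G *m A = A.
Proof.
have [k [L [R [L' [R' [_ AE LL RR]]]]]] := rank_factorization A.
exists (R' *m L'); rewrite {1 2}AE !mulmxA -(mulmxA L) RR mulmx1.
by rewrite -(mulmxA L) LL mulmx1.
Qed.

(** [E] fixes the columns of [M] and kills those of [N]; [G] does the same for the rows of [M] and
    [K]. By this independence, full-rank factorizations of the three blocks assemble into one of the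
    whole matrix. *)
Lemma mxrank_div_block m1 m2 n1 n2 (M : 'M[F]_(m1, n1)) (N : 'M_(m1, n2))
    (K : 'M_(m2, n1)) (E : 'M_m1) (G : 'M_n1) :
  E *m N = 0 -> K *m G = 0 -> M = E *m M *m G -> E *m E = E -> G *m G = G ->
  rk (block_mx M N K 0) = (rk M + (rk N + rk K))%N.
Proof.
move=> EN KG ME EE GG.
have [k1 [L1 [R1 [L1' [R1' [-> E1 LL1 RR1]]]]]] := rank_factorization M.
have [k2 [L2 [R2 [L2' [R2' [-> E2 LL2 RR2]]]]]] := rank_factorization N.
have [k3 [L3 [R3 [L3' [R3' [-> E3 LL3 RR3]]]]]] := rank_factorization K.
have L1E : L1 = M *m R1' by rewrite E1 -mulmxA RR1 mulmx1.
have R1E : R1 = L1' *m M by rewrite E1 mulmxA LL1 mul1mx.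
have L2E : L2 = N *m R2' by rewrite E2 -mulmxA RR2 mulmx1.
have R3E : R3 = L3' *m K by rewrite E3 mulmxA LL3 mul1mx.
have EL1 : E *m L1 = L1 by rewrite L1E mulmxA ME !mulmxA EE.
have RG1 : R1 *m G = R1 by rewrite R1E -mulmxA ME -!mulmxA GG.
have EL2 : E *m L2 = 0 by rewrite L2E mulmxA EN mul0mx.
have RG3 : R3 *m G = 0 by rewrite R3E -mulmxA KG mulmx0.
have -> : block_mx M N K 0 =
   block_mx L1 (row_mx L2 0) 0 (row_mx 0 L3) *m
   block_mx R1 0 (col_mx 0 R3) (col_mx R2 0).
  by rewrite mulmx_block !mul_row_col !(mulmx0, mul0mx) !(addr0, add0r) -E1 -E2 -E3.
apply: (@factorization_rank _ _ _ _ _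
  (block_mx (L1' *m E) 0 (col_mx (L2' *m (1%:M - E)) 0) (col_mx 0 L3'))
  (block_mx (G *m R1') (row_mx 0 ((1%:M - G) *m R3')) 0 (row_mx R2' 0))).
  rewrite mulmx_block !mul_col_row !mul_col_mx !mul_mx_row !(mulmx0, mul0mx) !(addr0, add0r).
  rewrite -!mulmxA EL1 EL2 LL1 !mulmxBl !mul1mx EL1 EL2 subrr subr0 !mulmx0 LL2 LL3.
  by rewrite add_block_mx !addr0 !add0r !col_mx0 !row_mx0 addr0 ?addr0 -!scalar_mx_block.
rewrite mulmx_block !mul_col_row !mul_mx_row !mul_col_mx !(mulmx0, mul0mx) !(addr0, add0r).
rewrite !mulmxA RG1 RG3 RR1 !mulmxBr !mulmx1 RG1 RG3 subrr subr0 !mul0mx RR3 RR2.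
by rewrite add_block_mx !addr0 !add0r !col_mx0 !row_mx0 addr0 ?addr0 -!scalar_mx_block.
Qed.


Lemma mxrank_div_mulr m n n' (A : 'M[F]_(m, n)) (Q : 'M_(n, n')) Q' :
  Q *m Q' = 1%:M -> rk (A *m Q) = rk A.
Proof.
move=> QQ; apply: (@mxrank_div_eq _ _ _ _ _ _ 1%:M Q 1%:M Q').
  by rewrite mul1mx.
by rewrite mul1mx -mulmxA QQ mulmx1.
Qed.

Lemma mxrank_div_rowC m n1 n2 (A : 'M[F]_(m, n1)) (B : 'M_(m, n2)) :
  rk (row_mx A B) = rk (row_mx B A).
Proof.
have -> : row_mx A B = row_mx B A *m block_mx 0 1%:M 1%:M 0.
  by rewrite mul_row_block !mulmx1 !mulmx0 add0r addr0.
apply: (@mxrank_div_mulr _ _ _ _ _ (block_mx 0 1%:M 1%:M 0)).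
by rewrite mulmx_block !mulmx1 !mulmx0 !addr0 !add0r -scalar_mx_block.
Qed.

Lemma mxrank_div_rowAC m n1 n2 n3 (A : 'M[F]_(m, n1)) (B : 'M_(m, n2)) (C : 'M_(m, n3)) :
  rk (row_mx A (row_mx B C)) = rk (row_mx A (row_mx C B)).
Proof.
pose Q a b : 'M[F]_(a + b, b + a) := block_mx 0 1%:M 1%:M 0.
have QQ a b : Q a b *m Q b a = 1%:M.
  by rewrite mulmx_block !mulmx1 !mulmx0 !addr0 !add0r -scalar_mx_block.
have -> : row_mx A (row_mx B C) = row_mx A (row_mx C B) *m block_mx 1%:M 0 0 (Q _ _).
  by rewrite !mul_row_block !mulmx1 !mulmx0 !add0r !addr0.
apply: (@mxrank_div_mulr _ _ _ _ _ (block_mx 1%:M 0 0 (Q _ _))).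
by rewrite mulmx_block QQ !mulmx1 !mulmx0 !mul0mx !addr0 !add0r -scalar_mx_block.
Qed.

(** The two bracketings differ by a cast of sizes; as multiplication by a right-invertible [Q], it
    is absorbed by [mxrank_div_mulr]. *)
Lemma row_mxA_mul n1 n2 n3 : exists Q Q' : 'M[F]_(_, _),
  (forall m (A : 'M[F]_(m, n1)) (B : 'M_(m, n2)) (C : 'M_(m, n3)),
     row_mx A (row_mx B C) = row_mx (row_mx A B) C *m Q) /\ Q *m Q' = 1%:M.
Proof.
have castQ n n' (e : n = n') : exists Q Q' : 'M[F]_(_, _),
    (forall m (A : 'M[F]_(m, n)), castmx (erefl m, e) A = A *m Q) /\ Q *m Q' = 1%:M.
  case: _ / e; exists 1%:M, 1%:M; split; last by rewrite mulmx1.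
  by move=> m A; rewrite castmx_id mulmx1.
have [Q [Q' [QE QQ]]] := castQ _ _ (esym (addnA n1 n2 n3)).
by exists Q, Q'; split=> // m A B C; rewrite row_mxA QE.
Qed.

Lemma mxrank_div_colA m1 m2 m3 n (A : 'M[F]_(m1, n)) (B : 'M_(m2, n)) (C : 'M_(m3, n)) :
  rk (col_mx A (col_mx B C)) = rk (col_mx (col_mx A B) C).
Proof.
rewrite -mxrank_div_ct -[RHS]mxrank_div_ct !ctmx_col.
by have [Q [Q' [-> QQ]]] := row_mxA_mul m1 m2 m3; apply: mxrank_div_mulr QQ.
Qed.

(** [E] projects onto the left annihilator of [A]: if [x *m A = 0], then [x = x *m E]. *)
Lemma left_annihilator m n (A : 'M[F]_(m, n)) :
  exists E G, [/\ E *m A = 0 & A *m G + E = 1%:M].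
Proof.
have [G AGA] := ginv A; exists (1%:M - A *m G), G; split.
  by rewrite mulmxBl mul1mx AGA subrr.
by rewrite addrC subrK.
Qed.

Lemma right_annihilator m n (A : 'M[F]_(m, n)) :
  exists E G, [/\ A *m E = 0 & G *m A + E = 1%:M].
Proof.
have [G AGA] := ginv A; exists (1%:M - G *m A), G; split.
  by rewrite mulmxBr mulmx1 mulmxA AGA subrr.
by rewrite addrC subrK.
Qed.

(** * Rank equalities as vanishing conditions on kernels *)

Definition vanishes_on_kernels m n b c (M : 'M[F]_(m, n)) (N : 'M_(m, b)) (K : 'M_(c, n)) :=
  forall k l (x : 'M_(k, m)) (v : 'M_(n, l)),
    x *m N = 0 -> K *m v = 0 -> x *m M *m v = 0.

(** Elimination with [N] and [K] reduces [M] to the corner [E *m M *m G], and by [mxrank_div_block]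
    the rank equality says that this corner is zero. As [x] and [v] range over matrices, the
    annihilators [E] and [G] are themselves admissible. *)
Lemma mxrank_div_blockP m1 m2 n1 n2 (M : 'M[F]_(m1, n1)) (N : 'M_(m1, n2))
    (K : 'M_(m2, n1)) :
  rk (col_mx (row_mx M N) (row_mx K 0)) = (rk N + rk K)%N <->
  vanishes_on_kernels M N K.
Proof.
have [E [U [EN NE]]] := left_annihilator N.
have [G [V [KG KE]]] := right_annihilator K.
have EE : E *m E = E by rewrite -{3}[E]mulmx1 -NE mulmxDr mulmxA EN mul0mx add0r.
have GG : G *m G = G by rewrite -{3}[G]mul1mx -KE mulmxDl -mulmxA KG mulmx0 add0r.
pose M1 := E *m M *m G.
have ME : M = M1 + E *m M *m V *m K + N *m (U *m M).
  rewrite -[LHS]mul1mx -NE mulmxDl addrC mulmxA; congr (_ + _).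
  by rewrite -[LHS]mulmx1 -KE mulmxDr addrC mulmxA.
have -> : rk (col_mx (row_mx M N) (row_mx K 0)) = rk (block_mx M1 N K 0).
  apply: (@mxrank_div_eq _ _ _ _ _ _
     (block_mx 1%:M (E *m M *m V) 0 1%:M) (block_mx 1%:M 0 (U *m M) 1%:M)
     (block_mx 1%:M (- (E *m M *m V)) 0 1%:M) (block_mx 1%:M 0 (- (U *m M)) 1%:M)).
    rewrite !mulmx_block !(mul1mx, mulmx1, mul0mx, mulmx0, add0r, addr0).
    by rewrite -ME.
  rewrite -[col_mx _ _]/(block_mx M N K 0).
  rewrite !mulmx_block !(mul1mx, mulmx1, mul0mx, mulmx0, add0r, addr0).
  congr block_mx; rewrite [X in _ = X + _ + _]ME mulNmx mulmxN.
  by rewrite addrAC !addrK.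
rewrite (@mxrank_div_block _ _ _ _ _ _ _ E G) //; last first.
  by rewrite /M1 !mulmxA EE -!mulmxA GG.
split=> [/eqP|van].
  rewrite -[X in _ == X]add0n eqn_add2r => /eqP/mxrank_div_eq0 M10 k l x v xN Kv.
  rewrite ME M10 add0r mulmxDr mulmxDl !mulmxA xN !mul0mx addr0.
  by rewrite -(mulmxA _ K) Kv mulmx0.
by rewrite /M1 van // mxrank_div0.
Qed.

Lemma mxrank_div_diag2P m1 m2 m3 n1 n2 n3 (P1 : 'M[F]_(m1, n1)) (P2 : 'M_(m2, n2))
    (N1 : 'M_(m1, n3)) (N2 : 'M_(m2, n3)) (K1 : 'M_(m3, n1)) (K2 : 'M_(m3, n2)) :
  rk (col_mx (row_mx P1 (row_mx 0 N1))
     (col_mx (row_mx 0 (row_mx P2 N2))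
             (row_mx K1 (row_mx K2 0)))) = (rk (col_mx N1 N2) + rk (row_mx K1 K2))%N <->
  (forall k l (x1 : 'M_(k, m1)) (x2 : 'M_(k, m2)) (v1 : 'M_(n1, l)) (v2 : 'M_(n2, l)),
     x1 *m N1 + x2 *m N2 = 0 -> K1 *m v1 + K2 *m v2 = 0 ->
     x1 *m P1 *m v1 + x2 *m P2 *m v2 = 0).
Proof.
rewrite mxrank_div_colA; have [Q [Q' [QE QQ]]] := row_mxA_mul n1 n2 n3.
rewrite !QE -!mul_col_mx (mxrank_div_mulr _ QQ).
rewrite -[col_mx (row_mx (row_mx P1 _) _) _]/(block_mx _ _ _ _) block_mxEh.
rewrite mxrank_div_blockP; split=> [van k l x1 x2 v1 v2 xN Kv|van k l x v].
  have := van k l (row_mx x1 x2) (col_mx v1 v2).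
  by rewrite !(mul_row_col, mul_mx_row) add_row_mx !mulmx0 addr0 add0r mul_row_col; apply.
rewrite -[x]hsubmxK -[v]vsubmxK !(mul_row_col, mul_mx_row) add_row_mx.
rewrite !mulmx0 addr0 add0r mul_row_col.
exact: van.
Qed.

(** Regrouping the first two diagonal blocks into one reduces this to [mxrank_div_diag2P]. *)
Lemma mxrank_div_diag3P m1 m2 m3 m4 n1 n2 n3 n4
    (P1 : 'M[F]_(m1, n1)) (P2 : 'M_(m2, n2)) (P3 : 'M_(m3, n3))
    (N1 : 'M_(m1, n4)) (N2 : 'M_(m2, n4)) (N3 : 'M_(m3, n4))
    (K1 : 'M_(m4, n1)) (K2 : 'M_(m4, n2)) (K3 : 'M_(m4, n3)) :
  rk (col_mx (row_mx P1 (row_mx 0 (row_mx 0 N1)))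
     (col_mx (row_mx 0 (row_mx P2 (row_mx 0 N2)))
     (col_mx (row_mx 0 (row_mx 0 (row_mx P3 N3)))
             (row_mx K1 (row_mx K2 (row_mx K3 0)))))) =
    (rk (col_mx N1 (col_mx N2 N3)) + rk (row_mx K1 (row_mx K2 K3)))%N <->
  (forall k l (x1 : 'M_(k, m1)) (x2 : 'M_(k, m2)) (x3 : 'M_(k, m3))
      (v1 : 'M_(n1, l)) (v2 : 'M_(n2, l)) (v3 : 'M_(n3, l)),
     x1 *m N1 + x2 *m N2 + x3 *m N3 = 0 -> K1 *m v1 + K2 *m v2 + K3 *m v3 = 0 ->
     x1 *m P1 *m v1 + x2 *m P2 *m v2 + x3 *m P3 *m v3 = 0).
Proof.
rewrite mxrank_div_colA; have [Q [Q' [QE QQ]]] := row_mxA_mul n1 n2 (n3 + n4).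
rewrite !QE -!mul_col_mx (mxrank_div_mulr _ QQ) {QE QQ}.
have [Q3 [Q3' [QE QQ]]] := row_mxA_mul n1 n2 n3.
rewrite (QE _ K1) (mxrank_div_mulr _ QQ) mxrank_div_colA.
rewrite -[col_mx (row_mx (row_mx P1 _) _) _]/(block_mx _ _ _ _) block_mxEh.
rewrite -[col_mx (row_mx 0 _) (row_mx 0 _)]/(block_mx _ _ _ _) block_mxEh col_mx0 row_mx0.
rewrite -mxrank_div_colA (mxrank_div_colA N1) mxrank_div_diag2P.
split=> [van k l x1 x2 x3 v1 v2 v3 xN Kv|van k l x x3 v v3].
  have := van k l (row_mx x1 x2) x3 (col_mx v1 v2) v3.
  by rewrite !(mul_row_col, mul_mx_row) add_row_mx !mulmx0 addr0 add0r mul_row_col; apply.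
rewrite -[x]hsubmxK -[v]vsubmxK !(mul_row_col, mul_mx_row) add_row_mx.
rewrite !mulmx0 addr0 add0r mul_row_col.
exact: van.
Qed.

Lemma mxrank_div_rowP m n1 n2 (C : 'M[F]_(m, n1)) (W : 'M_(m, n2)) :
  rk (row_mx C W) = rk C <->
  forall k (x : 'M_(k, m)), x *m C = 0 -> x *m W = 0.
Proof.
(* With [W] in the corner and an empty lower block row, [v] is unconstrained in the kernel criterion
   and may be the identity. *)
have -> : rk (row_mx C W) = rk (col_mx (row_mx W C) (row_mx (0 : 'M_(0, n2)) 0)).
  apply: (@mxrank_div_eq _ _ _ _ _ _ (row_mx 1%:M 0) (block_mx 0 1%:M 1%:M 0)
            (col_mx 1%:M 0) (block_mx 0 1%:M 1%:M 0)).
    rewrite mul_row_col mul1mx mul0mx addr0 mul_row_block !mulmx0 !mulmx1.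
    by rewrite add0r addr0.
  rewrite -mulmxA mul_row_block !mulmx0 !mulmx1 add0r addr0 mul_col_mx mul1mx.
  by rewrite mul0mx row_mx0.
have -> : rk C = (rk C + rk (0%R : 'M[F]_(0, n2)))%N by rewrite mxrank_div0 addn0.
rewrite mxrank_div_blockP.
split=> [van k x xC|xW k l x v xC _]; last by rewrite xW ?mul0mx.
by have := van _ _ x 1%:M xC; rewrite mul0mx mulmx1; apply.
Qed.

Lemma mxrank_div_colP m1 m2 n (D : 'M[F]_(m1, n)) (W : 'M_(m2, n)) :
  rk (col_mx D W) = rk D <->
  forall k (v : 'M_(n, k)), D *m v = 0 -> W *m v = 0.
Proof.
rewrite -mxrank_div_ct -(mxrank_div_ct D) (ctmx_col star) mxrank_div_rowP.
split=> van k x x0.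
  apply: (ctmx_inj starP); rewrite (ctmxM starP) van ?(ctmx0 starP) //.
  by rewrite -(ctmxM starP) x0 (ctmx0 starP).
apply: (ctmx_inj starP); rewrite (ctmxM starP) (ctmxK starP) van ?(ctmx0 starP) //.
by rewrite -{1}[D](ctmxK starP) -(ctmxM starP) x0 (ctmx0 starP).
Qed.

(** * Solvability of linear matrix equations *)

Lemma solve_two_sided m n p q (A : 'M[F]_(m, p)) (B : 'M_(q, n)) (G : 'M_(m, n)) :
  (forall k (x : 'M_(k, m)), x *m A = 0 -> x *m G = 0) ->
  (forall k (v : 'M_(n, k)), B *m v = 0 -> G *m v = 0) ->
  exists X, A *m X *m B = G.
Proof.
move=> lG rG; have [E [U [EA AE]]] := left_annihilator A.
have [K [V [BK KE]]] := right_annihilator B.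
exists (U *m G *m V).
have GE : G = A *m U *m G by rewrite -{1}[G]mul1mx -AE mulmxDl (lG _ E) ?addr0.
have GV : G = G *m (V *m B) by rewrite -{1}[G]mulmx1 -KE mulmxDr (rG _ K) ?addr0.
by rewrite !mulmxA -GE -mulmxA -GV.
Qed.

(** Given [X2], an [X1] exists once the residue is killed by the left annihilator [E] of [A1] and by
    the right annihilator [H] of [B1]. This leaves two equations for [X2], whose separate solutions
    [P] and [S] are glued. *)
Lemma solve_two_terms m n p1 q1 p2 q2 (A1 : 'M[F]_(m, p1)) (B1 : 'M_(q1, n))
    (A2 : 'M_(m, p2)) (B2 : 'M_(q2, n)) (G : 'M_(m, n)) :
  (forall k (x : 'M_(k, m)), x *m A1 = 0 -> x *m A2 = 0 -> x *m G = 0) ->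
  (forall k (v : 'M_(n, k)), B1 *m v = 0 -> B2 *m v = 0 -> G *m v = 0) ->
  vanishes_on_kernels G A1 B2 -> vanishes_on_kernels G A2 B1 ->
  exists X1 X2, A1 *m X1 *m B1 + A2 *m X2 *m B2 = G.
Proof.
move=> lG rG G12 G21.
have [E [U [EA AE]]] := left_annihilator A1.
have [H [V [BH HE]]] := right_annihilator B1.
have [P PE] : exists P, (E *m A2) *m P *m B2 = E *m G.
  apply: solve_two_sided => [k x|k v Bv]; last by rewrite G12.
  by rewrite !mulmxA => xEA; apply: lG => //; rewrite -mulmxA EA mulmx0.
have [S SE] : exists S, A2 *m S *m (B2 *m H) = G *m H.
  apply: solve_two_sided => [k x xA|k v]; first by rewrite mulmxA G21.
  by rewrite -!mulmxA => BHv; apply: rG => //; rewrite mulmxA BH mul0mx.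
have [T KTK] := ginv (B2 *m H); set K := B2 *m H in SE KTK.
(* [E *m A2 *m P *m K] and [E *m A2 *m S *m K] both equal [E *m G *m H], so the correction preserves
   the equation of [P]; since [K *m T *m K = K], it gives [X2 *m K = S *m K]. *)
pose X2 := P + (S - P) *m K *m T.
have EX2 : E *m (A2 *m X2 *m B2) = E *m G.
  suff EZ : E *m (A2 *m ((S - P) *m K)) = 0.
    have -> : E *m (A2 *m X2 *m B2) =
        E *m A2 *m P *m B2 + E *m (A2 *m ((S - P) *m K)) *m (T *m B2).
      by rewrite /X2 mulmxDr mulmxDl mulmxDr !mulmxA.
    by rewrite EZ mul0mx addr0.
  have ES : E *m A2 *m S *m B2 *m H = E *m G *m H.
    by rewrite -(mulmxA E G) -SE /K !mulmxA.
  by rewrite mulmxBl !mulmxBr /K !mulmxA ES PE subrr.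
have X2H : A2 *m X2 *m B2 *m H = G *m H.
  have -> : A2 *m X2 *m B2 *m H = A2 *m (P *m K) + A2 *m ((S - P) *m (K *m T *m K)).
    by rewrite /X2 /K; move: (S - P) => W; rewrite mulmxDr !mulmxDl !mulmxA.
  by rewrite KTK mulmxBl mulmxBr addrC subrK mulmxA SE.
have [X1 X1E] : exists X1, A1 *m X1 *m B1 = G - A2 *m X2 *m B2.
  apply: solve_two_sided => [k x xA|k v Bv].
    have -> : x = x *m E by rewrite -{1}[x]mulmx1 -AE mulmxDr mulmxA xA mul0mx add0r.
    by rewrite -mulmxA mulmxBr EX2 subrr mulmx0.
  have -> : v = H *m v by rewrite -{1}[v]mul1mx -HE mulmxDl -mulmxA Bv mulmx0 add0r.
  by rewrite mulmxA mulmxBl X2H subrr mul0mx.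
by exists X1, X2; rewrite X1E subrK.
Qed.

(* The forms e Z1 + Z2 f are those vanishing on pairs of a row killed by e and a
   column killed by f. *)
Lemma solve_corner m n p q (A : 'M[F]_(m, p)) (U : 'M_(p, q)) (B : 'M_(q, n))
    (e : 'M_p) (f : 'M_q) :
  vanishes_on_kernels (A *m U *m B) (A *m e) (f *m B) ->
  exists Z1 Z2, A *m (e *m Z1 + Z2 *m f) *m B = A *m U *m B.
Proof.
set G := A *m U *m B => van.
have [E [S [EN NE]]] := left_annihilator (A *m e).
have [H [T [KH HE]]] := right_annihilator (f *m B).
(* [Z1] produces the part [A *m e *m S *m G] of [G]; the rest [E *m G] factors through [f *m B] and
   is produced by [Z2]. *)
exists (S *m A *m U), ((1%:M - e *m S *m A) *m U *m B *m T).
have EG : E *m G = E *m G *m T *m f *m B.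
  by rewrite -{1}[E *m G]mulmx1 -HE mulmxDr (van _ _ E H) // addr0 !mulmxA.
have -> : G = A *m e *m S *m G + E *m G by rewrite -mulmxDl NE mul1mx.
rewrite EG mulmxDr mulmxDl; congr (_ + _); first by rewrite /G !mulmxA.
have -> : E = 1%:M - A *m e *m S by rewrite -NE addrAC subrr add0r.
by rewrite /G !(mulmxBl, mulmxBr) !mulmxA !(mul1mx, mulmx1).
Qed.

(** Adding [e *m Z1 + Z2 *m f] preserves the first equation. By [solve_corner] such a term repairs
    the second one if the defect vanishes where the two row spaces and the two column spaces meet,
    which is the compatibility hypothesis. *)
Lemma solve_pair p q a1 b1 a2 b2 (A1 : 'M[F]_(a1, p)) (B1 : 'M_(q, b1)) C1
    (A2 : 'M_(a2, p)) (B2 : 'M_(q, b2)) C2 :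
  (exists X, A1 *m X *m B1 = C1) -> (exists X, A2 *m X *m B2 = C2) ->
  (forall k l (x : 'M_(k, a1)) (y : 'M_(k, a2)) (u : 'M_(b1, l)) (v : 'M_(b2, l)),
     x *m A1 = y *m A2 -> B1 *m u = B2 *m v -> x *m C1 *m u = y *m C2 *m v) ->
  exists X, A1 *m X *m B1 = C1 /\ A2 *m X *m B2 = C2.
Proof.
move=> [X1 E1] [X2 E2] H12.
have [e [G [Ae GE]]] := right_annihilator A1.
have [f [H [fB HE]]] := left_annihilator B1.
have [k l x v xAe fBv|Z1 [Z2 ZE]] := @solve_corner _ _ _ _ A2 (X2 - X1) B2 e f.
  have xA : x *m A2 *m G *m A1 = x *m A2.
    by rewrite -[RHS]mulmx1 -GE mulmxDr -(mulmxA x A2 e) xAe addr0 mulmxA.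
  have Bv : B1 *m (H *m (B2 *m v)) = B2 *m v.
    by rewrite -[RHS]mul1mx -HE mulmxDl (mulmxA f B2 v) fBv addr0 mulmxA.
  rewrite mulmxBr mulmxBl E2 mulmxBr mulmxBl -(H12 _ _ _ _ _ _ xA Bv) -E1.
  by rewrite !mulmxA xA -!mulmxA Bv subrr.
exists (X1 + (e *m Z1 + Z2 *m f)); split.
  rewrite mulmxDr mulmxDl E1 mulmxDr mulmxDl mulmxA Ae -!mulmxA fB.
  by rewrite !mulmx0 !mul0mx !addr0.
by rewrite mulmxDr mulmxDl ZE mulmxBr mulmxBl addrC subrK.
Qed.

(** A solution [X0] of the first two equations is changed only by forms that preserve both;
    compatibility ensures that these account for the residue [G] of the third. *)
Lemma solve_triple p q a1 b1 a2 b2 a3 b3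
    (A1 : 'M[F]_(a1, p)) (B1 : 'M_(q, b1)) C1
    (A2 : 'M_(a2, p)) (B2 : 'M_(q, b2)) C2
    (A3 : 'M_(a3, p)) (B3 : 'M_(q, b3)) C3 :
  (exists X, A1 *m X *m B1 = C1 /\ A2 *m X *m B2 = C2) ->
  (exists X, A3 *m X *m B3 = C3) ->
  (forall k l (x : 'M_(k, a3)) (y : 'M_(k, a1)) (v : 'M_(b3, l)) (w : 'M_(b1, l)),
     x *m A3 = y *m A1 -> B3 *m v = B1 *m w -> x *m C3 *m v = y *m C1 *m w) ->
  (forall k l (x : 'M_(k, a3)) (y : 'M_(k, a2)) (v : 'M_(b3, l)) (w : 'M_(b2, l)),
     x *m A3 = y *m A2 -> B3 *m v = B2 *m w -> x *m C3 *m v = y *m C2 *m w) ->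
  (forall k l (x : 'M_(k, a3)) (y1 : 'M_(k, a1)) (y2 : 'M_(k, a2))
      (v : 'M_(b3, l)) (w1 : 'M_(b1, l)) (w2 : 'M_(b2, l)),
     x *m A3 = y1 *m A1 -> x *m A3 = y2 *m A2 -> B3 *m v = B1 *m w1 + B2 *m w2 ->
     x *m C3 *m v = y1 *m C1 *m w1 + y2 *m C2 *m w2) ->
  (forall k l (x : 'M_(k, a3)) (y1 : 'M_(k, a1)) (y2 : 'M_(k, a2))
      (v : 'M_(b3, l)) (w1 : 'M_(b1, l)) (w2 : 'M_(b2, l)),
     x *m A3 = y1 *m A1 + y2 *m A2 -> B3 *m v = B1 *m w1 -> B3 *m v = B2 *m w2 ->
     x *m C3 *m v = y1 *m C1 *m w1 + y2 *m C2 *m w2) ->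
  exists X, [/\ A1 *m X *m B1 = C1, A2 *m X *m B2 = C2 & A3 *m X *m B3 = C3].
Proof.
move=> [X0 [E1 E2]] [X3 E3] H13 H23 HL HR.
pose G := A3 *m (X3 - X0) *m B3.
have xGv k l (x : 'M_(k, a3)) (v : 'M_(b3, l)) :
    x *m C3 *m v = x *m A3 *m X0 *m (B3 *m v) -> x *m G *m v = 0.
  by rewrite /G !(mulmxBr, mulmxBl) E3 => ->; rewrite !mulmxA subrr.
have {}H13 k l (x : 'M_(k, a3)) y (v : 'M_(b3, l)) w :
    x *m A3 = y *m A1 -> B3 *m v = B1 *m w -> x *m G *m v = 0.
  by move=> xy vw; apply: xGv; rewrite (H13 _ _ _ _ _ _ xy vw) xy vw -E1 !mulmxA.
have {}H23 k l (x : 'M_(k, a3)) y (v : 'M_(b3, l)) w :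
    x *m A3 = y *m A2 -> B3 *m v = B2 *m w -> x *m G *m v = 0.
  by move=> xy vw; apply: xGv; rewrite (H23 _ _ _ _ _ _ xy vw) xy vw -E2 !mulmxA.
have {}HL k l (x : 'M_(k, a3)) y1 y2 (v : 'M_(b3, l)) w1 w2 :
    x *m A3 = y1 *m A1 -> x *m A3 = y2 *m A2 -> B3 *m v = B1 *m w1 + B2 *m w2 ->
    x *m G *m v = 0.
  move=> xy1 xy2 vw; apply: xGv; rewrite (HL _ _ _ _ _ _ _ _ xy1 xy2 vw).
  by rewrite vw mulmxDr {1}xy1 xy2 -E1 -E2 !mulmxA.
have {}HR k l (x : 'M_(k, a3)) y1 y2 (v : 'M_(b3, l)) w1 w2 :
    x *m A3 = y1 *m A1 + y2 *m A2 -> B3 *m v = B1 *m w1 -> B3 *m v = B2 *m w2 ->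
    x *m G *m v = 0.
  move=> xy vw1 vw2; apply: xGv; rewrite (HR _ _ _ _ _ _ _ _ xy vw1 vw2).
  by rewrite xy !mulmxDl {1}vw1 vw2 -E1 -E2 !mulmxA.
have GE : A3 *m (X3 - X0) *m B3 = G by [].
clearbody G.
have [e1 [G1 [Ae1 Ge1]]] := right_annihilator A1.
have [e2 [G2 [Ae2 Ge2]]] := right_annihilator A2.
have [e [G12 [Ae Ge]]] := right_annihilator (col_mx A1 A2).
have [f1 [H1 [fB1 Hf1]]] := left_annihilator B1.
have [f2 [H2 [fB2 Hf2]]] := left_annihilator B2.
have [f [H12 [fB Hf]]] := left_annihilator (row_mx B1 B2).
have {Ae} [A1e A2e] : A1 *m e = 0 /\ A2 *m e = 0.
  by move: Ae; rewrite mul_col_mx -[0]vsubmxK => /eq_col_mx[-> ->]; rewrite !linear0.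
have {fB} [fB1' fB2'] : f *m B1 = 0 /\ f *m B2 = 0.
  by move: fB; rewrite mul_mx_row -[0]hsubmxK => /eq_row_mx[-> ->]; rewrite !linear0.
rewrite -[G12]hsubmxK mul_row_col in Ge; rewrite -[H12]vsubmxK mul_row_col in Hf.
(* A row killed by [e1], [e2] or [e] lies in the row space of [A1], of [A2] or in their sum; [f1],
   [f2] and [f] play this role for columns. *)
have in1 k (x : 'M_(k, p)) : x *m e1 = 0 -> x = x *m G1 *m A1.
  by move=> x0; rewrite -[LHS]mulmx1 -Ge1 mulmxDr x0 addr0 mulmxA.
have in2 k (x : 'M_(k, p)) : x *m e2 = 0 -> x = x *m G2 *m A2.
  by move=> x0; rewrite -[LHS]mulmx1 -Ge2 mulmxDr x0 addr0 mulmxA.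
have in12 k (x : 'M_(k, p)) : x *m e = 0 ->
    x = x *m lsubmx G12 *m A1 + x *m rsubmx G12 *m A2.
  by move=> x0; rewrite -[LHS]mulmx1 -Ge mulmxDr x0 addr0 mulmxDr !mulmxA.
have im1 k (v : 'M_(q, k)) : f1 *m v = 0 -> v = B1 *m (H1 *m v).
  by move=> v0; rewrite -[LHS]mul1mx -Hf1 mulmxDl v0 addr0 mulmxA.
have im2 k (v : 'M_(q, k)) : f2 *m v = 0 -> v = B2 *m (H2 *m v).
  by move=> v0; rewrite -[LHS]mul1mx -Hf2 mulmxDl v0 addr0 mulmxA.
have im12 k (v : 'M_(q, k)) : f *m v = 0 ->
    v = B1 *m (usubmx H12 *m v) + B2 *m (dsubmx H12 *m v).
  by move=> v0; rewrite -[LHS]mul1mx -Hf mulmxDl v0 addr0 mulmxDl !mulmxA.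
(* [E] selects the combinations of rows of [A3] lying in the sum of the row spaces of [A1] and [A2];
   [H] does so for columns. *)
have [E [S [EN NE]]] := left_annihilator (A3 *m e).
have [H [T [KH HE]]] := right_annihilator (f *m B3).
(* The forms e1 X1 f2 + e2 X2 f1 vanish on A1 x B1 and on A2 x B2; they account for
   G up to forms e Z1 + Z2 f, which also do. *)
have [||||X1 [X2 XE]] := @solve_two_terms _ _ _ _ _ _ (E *m A3 *m e1) (f2 *m B3 *m H)
    (E *m A3 *m e2) (f1 *m B3 *m H) (E *m G *m H).
(* The four side conditions are [HL], [HR], [H13] and [H23] in turn, restricted by [E] and [H]. *)
- move=> k x; rewrite !mulmxA => /in1 x1 /in2 x2.
  by apply: HL x1 x2 (im12 _ _ _); rewrite mulmxA.
- move=> k v; rewrite -!mulmxA => /im2 v2 /im1 v1.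
  by rewrite mulmxA; apply: HR v1 v2; apply: in12; rewrite -mulmxA.
- move=> k l x v; rewrite !mulmxA -!(mulmxA f1) => /in1 x1 /im1 v1.
  by rewrite -(mulmxA _ H); apply: H13 x1 _; rewrite mulmxA; exact: v1.
- move=> k l x v; rewrite !mulmxA -!(mulmxA f2) => /in2 x2 /im2 v2.
  by rewrite -(mulmxA _ H); apply: H23 x2 _; rewrite mulmxA; exact: v2.
pose Y := e1 *m X1 *m f2 + e2 *m X2 *m f1.
have [k l x v xN Kv|Z1 [Z2 ZE]] := @solve_corner _ _ _ _ A3 (X3 - X0 - Y) B3 e f.
  have -> : x = x *m E by rewrite -{1}[x]mulmx1 -NE mulmxDr mulmxA xN mul0mx add0r.
  have -> : v = H *m v by rewrite -{1}[v]mul1mx -HE mulmxDl -mulmxA Kv mulmx0 add0r.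
  rewrite mulmxA -(mulmxA x) -(mulmxA x).
  suff -> : E *m (A3 *m (X3 - X0 - Y) *m B3) *m H = 0 by rewrite mulmx0 mul0mx.
  rewrite (mulmxBr A3) mulmxBl GE mulmxBr mulmxBl -XE /Y.
  by rewrite !(mulmxDr, mulmxDl) !mulmxA subrr.
exists (X0 + Y + (e *m Z1 + Z2 *m f)).
split; rewrite 2!mulmxDr 2!mulmxDl.
- rewrite E1 /Y 2!mulmxDr 2!mulmxDl !mulmxA Ae1 A1e -!mulmxA fB1 fB1'.
  by rewrite !(mulmx0, mul0mx) !addr0.
- rewrite E2 /Y 2!mulmxDr 2!mulmxDl !mulmxA Ae2 A2e -!mulmxA fB2 fB2'.
  by rewrite !(mulmx0, mul0mx) !addr0.
by rewrite ZE -!mulmxDl -!mulmxDr -(addrA X3) -opprD addrCA subrr addr0 E3.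
Qed.

End Rank.

(** * Hermitian solutions of the system *)

Section HermitianSystem.
Variables (F : unitRingType) (star : F -> F).
Hypothesis divF : GRing.field_axiom F.
Hypothesis charF : 2%N \notin [pchar F].
Hypothesis starP : involutive_antiautomorphism star.
Local Notation rk := mxrank_div.

(** With [G = B *m U] and [E = 1%:M - G], the vanishing of [E *m H *m E ^t star] gives [H = G *m H +
    H *m G ^t star - G *m H *m G ^t star]. Sharing the last term equally splits [H] into a left
    multiple of [G] and its conjugate transpose. *)
Lemma solve_lyapunov m q (B : 'M[F]_(m, q)) (H : 'M_m) :
  H = H ^t star -> vanishes_on_kernels H B (B ^t star) ->
  exists Y, B *m Y + (B *m Y) ^t star = H.
Proof.
move=> HH van; have [E [U [EB UE]]] := left_annihilator divF starP B.
have EHE : E *m H *m E ^t star = 0 by rewrite van // -(ctmxM starP) EB (ctmx0 starP).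
have [G GB] : exists G, G = B *m U by exists (B *m U).
have EE : E = 1%:M - G by rewrite GB -UE addrAC subrr add0r.
have HE : G *m H + H *m G ^t star - G *m H *m G ^t star = H.
  have ES : E ^t star = 1%:M - (G ^t star).
    by rewrite EE (ctmxD starP) (ctmxN starP) (ctmx1 starP).
  move/eqP: EHE; rewrite ES EE mulmxBr mulmx1 subr_eq0 !mulmxBl mul1mx => /eqP GE.
  by rewrite -addrA -GE addrC subrK.
exists (U *m (H - 2%:R^-1 *: (H *m G ^t star))).
rewrite mulmxA -GB mulmxBr mulmx_half mulmxA.
rewrite (ctmxD starP) (ctmxN starP) (ctmx_half divF charF starP).
rewrite !(ctmxM starP) (ctmxK starP) -HH mulmxA addrACA -opprD.
by rewrite (halfmxD divF charF).
Qed.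

Variables (m p q s t : nat).
Variables (A : 'M[F]_(m, p)) (B : 'M[F]_(m, q)) (C : 'M[F]_(s, p)).
Variables (D : 'M[F]_(p, t)) (Phi : 'M[F]_m) (Omega : 'M[F]_(s, t)).
Hypothesis PhiH : Phi = Phi ^t star.

Let flip k l (M N : 'M[F]_(k, l)) : M = N -> M ^t star = N ^t star.
Proof. by move->. Qed.

Lemma system_from_kernels :
  (forall k l (x : 'M_(k, m)) (v : 'M_(m, l)),
     x *m A = 0 -> x *m B = 0 -> B ^t star *m v = 0 -> x *m Phi *m v = 0) ->
  (forall k (x : 'M_(k, s)), x *m C = 0 -> x *m Omega = 0) ->
  (forall k (v : 'M_(t, k)), D *m v = 0 -> Omega *m v = 0) ->
  (forall k l (x1 : 'M_(k, m)) (x2 : 'M_(k, s)) (v1 : 'M_(m, l)) (v2 : 'M_(t, l)),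
     x1 *m A = x2 *m C -> x1 *m B = 0 -> A ^t star *m v1 = D *m v2 ->
     B ^t star *m v1 = 0 -> x1 *m Phi *m v1 = x2 *m Omega *m v2) ->
  (forall k l (x1 : 'M_(k, s)) (x2 : 'M_(k, t)) (v1 : 'M_(t, l)) (v2 : 'M_(s, l)),
     x1 *m C = x2 *m D ^t star -> D *m v1 = C ^t star *m v2 ->
     x1 *m Omega *m v1 = x2 *m Omega ^t star *m v2) ->
  (forall k l (x1 : 'M_(k, m)) (x2 : 'M_(k, s)) (x3 : 'M_(k, t))
      (v1 : 'M_(m, l)) (v2 : 'M_(t, l)) (v3 : 'M_(s, l)),
     x1 *m A = x2 *m C -> x1 *m A = x3 *m D ^t star -> x1 *m B = 0 ->
     A ^t star *m v1 = D *m v2 + C ^t star *m v3 -> B ^t star *m v1 = 0 ->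
     x1 *m Phi *m v1 = x2 *m Omega *m v2 + x3 *m Omega ^t star *m v3) ->
  exists (X : 'M[F]_p) (Y : 'M[F]_(q, m)),
    [/\ A *m X *m A ^t star + B *m Y + (B *m Y) ^t star = Phi,
        C *m X *m D = Omega & X = X ^t star].
Proof.
move=> c1 c2 c3 c4 c5 c6.
have [Q [U [QB QE]]] := left_annihilator divF starP B.
have BQ : B ^t star *m Q ^t star = 0 by rewrite -(ctmxM starP) QB (ctmx0 starP).
have QB0 k (x : 'M_(k, m)) : x *m Q *m B = 0 by rewrite -mulmxA QB mulmx0.
have BQ0 k (v : 'M_(m, k)) : B ^t star *m (Q ^t star *m v) = 0 by rewrite mulmxA BQ mul0mx.
(* Multiplying by [Q] on the left and [Q ^t star] on the right eliminates [Y]. *)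
pose A1 := Q *m A; pose P1 := Q *m Phi *m Q ^t star.
have P1H : P1 ^t star = P1.
  by rewrite /P1 !(ctmxM starP) (ctmxK starP) -PhiH mulmxA.
have A1E : A1 ^t star = A ^t star *m Q ^t star by rewrite (ctmxM starP).
have [X0 X0E] : exists X, C *m X *m D = Omega by exact: (solve_two_sided divF starP).
(* The conjugate transposed equation is imposed too, so that the Hermitian part of [X] still
   satisfies [C *m X *m D = Omega]; the two are compatible by [c5]. *)
have e12 : exists X, C *m X *m D = Omega /\ D ^t star *m X *m C ^t star = Omega ^t star.
  apply: (solve_pair divF starP) => //; first by exists X0.
  by exists (X0 ^t star); rewrite -X0E !(ctmxM starP) mulmxA.
have l1 k (x : 'M_(k, m)) : x *m A1 = 0 -> x *m P1 = 0.
  by rewrite /A1 /P1 !mulmxA => xA; apply: c1 xA (QB0 _ _) BQ.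
have e3 : exists X, A1 *m X *m A1 ^t star = P1.
  apply: (solve_two_sided divF starP) => // k v Av.
  apply: (ctmx_inj starP); rewrite (ctmxM starP) P1H l1 ?(ctmx0 starP) //.
  by rewrite -[A1](ctmxK starP) -(ctmxM starP) Av (ctmx0 starP).
have H31 k l (x : 'M_(k, m)) (y : 'M_(k, s)) (v : 'M_(m, l)) (w : 'M_(t, l)) :
    x *m A1 = y *m C -> A1 ^t star *m v = D *m w ->
    x *m P1 *m v = y *m Omega *m w.
  rewrite A1E -mulmxA /A1 mulmxA => xy vw.
  by rewrite -(c4 _ _ _ _ _ _ xy _ vw) // /P1 !mulmxA.
have H3L k l (x : 'M_(k, m)) (y1 : 'M_(k, s)) (y2 : 'M_(k, t))
    (v : 'M_(m, l)) (w1 : 'M_(t, l)) (w2 : 'M_(s, l)) :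
    x *m A1 = y1 *m C -> x *m A1 = y2 *m D ^t star ->
    A1 ^t star *m v = D *m w1 + C ^t star *m w2 ->
    x *m P1 *m v = y1 *m Omega *m w1 + y2 *m Omega ^t star *m w2.
  rewrite A1E -mulmxA /A1 mulmxA => xy1 xy2 vw.
  by rewrite -(c6 _ _ _ _ _ _ _ _ xy1 xy2 _ vw) // /P1 !mulmxA.
have P1E : P1 = Q *m Phi *m Q ^t star by [].
have A1Q : A1 = Q *m A by [].
clearbody A1 P1.
(* The two hypotheses left open are the conjugate transposes of [H31] and [H3L]. *)
have [||X [XC XD XA]] := solve_triple divF starP e12 e3 H31 _ H3L.
- move=> k l x y v w /flip + /flip; rewrite !(ctmxM starP) !(ctmxK starP) => xy vw.
  apply: (ctmx_inj starP); rewrite !(ctmxM starP) !(ctmxK starP) P1H.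
  by rewrite !mulmxA (H31 _ _ _ _ _ _ vw xy).
- move=> k l x y1 y2 v w1 w2 /flip + /flip + /flip.
  rewrite (ctmxD starP) !(ctmxM starP) !(ctmxK starP) addrC => xy vw1 vw2.
  apply: (ctmx_inj starP); rewrite (ctmxD starP) !(ctmxM starP) !(ctmxK starP) P1H !mulmxA.
  by rewrite addrC; apply: H3L.
pose X' := 2%:R^-1 *: (X + X ^t star).
have X'E a b (M : 'M_(a, p)) (N : 'M_(p, b)) W :
    M *m X *m N = W -> M *m X ^t star *m N = W -> M *m X' *m N = W.
  move=> E1 E2; rewrite /X' mulmx_half -scalemxAl.
  by rewrite mulmxDr mulmxDl E1 E2 scalerDr (halfmxD divF charF).
have X'H : X' = X' ^t star.
  by rewrite /X' (ctmx_half divF charF starP) (ctmxD starP) (ctmxK starP) addrC.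
have X'A : A1 *m X' *m A1 ^t star = P1.
  apply: X'E => //; apply: (ctmx_inj starP).
  by rewrite !(ctmxM starP) !(ctmxK starP) P1H mulmxA.
have [Y YE] : exists Y, B *m Y + (B *m Y) ^t star = Phi - A *m X' *m A ^t star.
  apply: solve_lyapunov => [|k l x v xB Bv].
    by rewrite (ctmxD starP) (ctmxN starP) -PhiH !(ctmxM starP) (ctmxK starP) -X'H mulmxA.
  have -> : x = x *m Q by rewrite -{1}[x]mulmx1 -QE mulmxDr mulmxA xB mul0mx add0r.
  have -> : v = Q ^t star *m v.
    rewrite -{1}[v]mul1mx -(ctmx1 starP) -QE (ctmxD starP) (ctmxM starP) mulmxDl.
    by rewrite -mulmxA Bv mulmx0 add0r.
  rewrite mulmxA -(mulmxA x) -(mulmxA x) mulmxBr mulmxBl.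
  move: X'A; rewrite A1E A1Q P1E !mulmxA => ->.
  by rewrite subrr mulmx0 mul0mx.
exists X', Y; split=> //; first by rewrite -addrA YE addrC subrK.
apply: X'E => //; apply: (ctmx_inj starP).
by rewrite !(ctmxM starP) (ctmxK starP) mulmxA.
Qed.

(** * Rank equalities of the system as kernel conditions *)

Lemma col_row_mx m1 m2 n1 n2 (P : 'M[F]_(m1, n1)) (Q : 'M_(m1, n2))
    (R : 'M_(m2, n1)) (S : 'M_(m2, n2)) :
  col_mx (row_mx P Q) (row_mx R S) = row_mx (col_mx P R) (col_mx Q S).
Proof. exact: block_mxEh. Qed.

Lemma row_mx_eq0P k a b (M : 'M[F]_(k, a)) (N : 'M_(k, b)) :
  row_mx M N = 0 <-> M = 0 /\ N = 0.
Proof.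
split=> [/eqP|[-> ->]]; last by rewrite row_mx0.
by rewrite row_mx_eq0 => /andP[/eqP -> /eqP ->].
Qed.

Lemma col_mx_eq0P k a b (M : 'M[F]_(a, k)) (N : 'M_(b, k)) :
  col_mx M N = 0 <-> M = 0 /\ N = 0.
Proof.
split=> [/eqP|[-> ->]]; last by rewrite col_mx0.
by rewrite col_mx_eq0 => /andP[/eqP -> /eqP ->].
Qed.

Lemma rank_condition1P :
  rk (col_mx (row_mx Phi (row_mx A B)) (row_mx (B ^t star) (row_mx 0 0)))
    = (rk (row_mx A B) + rk B)%N <->
  (forall k l (x : 'M_(k, m)) (v : 'M_(m, l)),
     x *m A = 0 -> x *m B = 0 -> B ^t star *m v = 0 -> x *m Phi *m v = 0).
Proof.
rewrite row_mx0 -(mxrank_div_ct divF starP B) (mxrank_div_blockP divF starP).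
split=> van k l x v => [xA xB|]; first by apply: van; rewrite mul_mx_row xA xB row_mx0.
by rewrite mul_mx_row => /row_mx_eq0P[]; apply: van.
Qed.

(** Conjugate transposing the second rank on the right yields the lower left block of the large
    matrix. Negating [x2] and [v2] then turns vanishing sums into equalities. *)
Lemma rank_condition4P :
  rk (col_mx (row_mx Phi         (row_mx 0        (row_mx A B)))
     (col_mx (row_mx 0           (row_mx (- Omega) (row_mx C 0)))
     (col_mx (row_mx (A ^t star) (row_mx D        (row_mx 0 0)))
             (row_mx (B ^t star) (row_mx 0        (row_mx 0 0))))))
    = (rk (col_mx (row_mx A B) (row_mx C 0))
       + rk (col_mx (row_mx A B) (row_mx (D ^t star) 0)))%N <->
  (forall k l (x1 : 'M_(k, m)) (x2 : 'M_(k, s)) (v1 : 'M_(m, l)) (v2 : 'M_(t, l)),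
     x1 *m A = x2 *m C -> x1 *m B = 0 -> A ^t star *m v1 = D *m v2 ->
     B ^t star *m v1 = 0 -> x1 *m Phi *m v1 = x2 *m Omega *m v2).
Proof.
rewrite -(mxrank_div_ct divF starP (col_mx (row_mx A B) (row_mx (D ^t star) 0))).
rewrite ctmx_col !ctmx_row (ctmxK starP) (ctmx0 starP).
rewrite [col_mx (row_mx (A ^t star) _) _]col_row_mx [col_mx (row_mx D _) _]col_row_mx.
rewrite [col_mx (row_mx 0 0) _]col_row_mx !col_mx0 row_mx0.
rewrite (mxrank_div_diag2P divF starP); split=> van k l x1 x2 v1 v2.
  move=> xA xB Av Bv; have := van k l x1 (- x2) v1 (- v2).
  rewrite !mul_mx_row !mul_col_mx add_row_mx add_col_mx !mulmx0 !mul0mx !addr0.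
  rewrite !mulNmx !mulmxN !opprK xA Av xB Bv !subrr row_mx0 col_mx0 => /(_ erefl erefl)/eqP.
  by rewrite mulNmx subr_eq0 => /eqP.
rewrite !mul_mx_row !mul_col_mx add_row_mx add_col_mx !mulmx0 !mul0mx !addr0.
move=> /row_mx_eq0P[/eqP + xB] /col_mx_eq0P[/eqP + Bv].
rewrite !addr_eq0 -mulNmx -mulmxN => /eqP xA /eqP Av.
by rewrite (van _ _ _ _ _ _ xA xB Av Bv) !(mulNmx, mulmxN) opprK subrr.
Qed.

(** The factor 2 counts the rank of the stacked [C] and [D ^t star] once as it stands and once
    conjugate transposed. *)
Lemma rank_condition5P :
  rk (col_mx (row_mx Omega (row_mx 0                   C))
     (col_mx (row_mx 0     (row_mx (- (Omega ^t star)) (D ^t star)))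
             (row_mx D     (row_mx (C ^t star)         0))))
    = (2 * rk (col_mx C (D ^t star)))%N <->
  (forall k l (x1 : 'M_(k, s)) (x2 : 'M_(k, t)) (v1 : 'M_(t, l)) (v2 : 'M_(s, l)),
     x1 *m C = x2 *m D ^t star -> D *m v1 = C ^t star *m v2 ->
     x1 *m Omega *m v1 = x2 *m Omega ^t star *m v2).
Proof.
rewrite mul2n -addnn -[X in _ = (_ + X)%N](mxrank_div_ct divF starP) ctmx_col (ctmxK starP).
rewrite (mxrank_div_rowC divF starP) (mxrank_div_diag2P divF starP).
split=> van k l x1 x2 v1 v2.
  move=> xC Dv; have := van k l x1 (- x2) v1 (- v2).
  rewrite !mulNmx !mulmxN !opprK xC Dv !subrr => /(_ erefl erefl)/eqP.
  by rewrite mulNmx subr_eq0 => /eqP.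
move=> /eqP + /eqP; rewrite !addr_eq0 -mulNmx -mulmxN => /eqP xC /eqP Dv.
by rewrite (van _ _ _ _ _ _ xC Dv) !(mulNmx, mulmxN) opprK subrr.
Qed.

(** The two copies of [A] in separate block columns impose [x1 *m A = x2 *m C] and
    [x1 *m A = x3 *m D ^t star] separately, whereas the single [A ^t star] below gives one joint
    relation among columns. *)
Lemma rank_condition6P :
  rk (col_mx (row_mx Phi (row_mx 0 (row_mx 0 (row_mx A (row_mx A B)))))
     (col_mx (row_mx 0 (row_mx (- Omega) (row_mx 0 (row_mx C (row_mx 0 0)))))
     (col_mx (row_mx 0 (row_mx 0 (row_mx (- (Omega ^t star))
               (row_mx 0 (row_mx (D ^t star) 0)))))
     (col_mx (row_mx (A ^t star) (row_mx D (row_mx (C ^t star)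
               (row_mx 0 (row_mx 0 0)))))
             (row_mx (B ^t star) (row_mx 0 (row_mx 0
               (row_mx 0 (row_mx 0 0)))))))))
    = (rk (col_mx (row_mx A (row_mx A B))
          (col_mx (row_mx C (row_mx 0 0)) (row_mx 0 (row_mx (D ^t star) 0))))
       + rk (col_mx (row_mx A B) (col_mx (row_mx C 0) (row_mx (D ^t star) 0))))%N <->
  (forall k l (x1 : 'M_(k, m)) (x2 : 'M_(k, s)) (x3 : 'M_(k, t))
      (v1 : 'M_(m, l)) (v2 : 'M_(t, l)) (v3 : 'M_(s, l)),
     x1 *m A = x2 *m C -> x1 *m A = x3 *m D ^t star -> x1 *m B = 0 ->
     A ^t star *m v1 = D *m v2 + C ^t star *m v3 -> B ^t star *m v1 = 0 ->
     x1 *m Phi *m v1 = x2 *m Omega *m v2 + x3 *m Omega ^t star *m v3).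
Proof.
rewrite -(mxrank_div_ct divF starP (col_mx (row_mx A B) _)).
rewrite !ctmx_col !ctmx_row (ctmxK starP) !(ctmx0 starP) (mxrank_div_rowAC divF starP).
rewrite [col_mx (row_mx (A ^t star) _) _]col_row_mx [col_mx (row_mx D _) _]col_row_mx.
rewrite [col_mx (row_mx (C ^t star) _) _]col_row_mx.
rewrite 2![col_mx (row_mx 0 _) (row_mx 0 _)]col_row_mx !col_mx0 !(row_mx0 _ (p + q)).
rewrite (mxrank_div_diag3P divF starP); split=> van k l x1 x2 x3 v1 v2 v3.
  move=> xC xD xB Av Bv; have := van k l x1 (- x2) (- x3) v1 (- v2) (- v3).
  rewrite !mul_mx_row !mul_col_mx !(add_row_mx, add_col_mx) !mulmx0 !mul0mx !addr0.
  rewrite !(mulNmx, mulmxN) !opprK Av xB Bv xD subrr -{1}xD xC subrr !row_mx0.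
  rewrite -addrA -opprD subrr col_mx0 => /(_ erefl erefl)/eqP.
  by rewrite -addrA -opprD subr_eq0 => /eqP.
rewrite !mul_mx_row !mul_col_mx !(add_row_mx, add_col_mx) !mulmx0 !mul0mx !addr0.
move=> /row_mx_eq0P[/eqP + /row_mx_eq0P[/eqP + xB]] /col_mx_eq0P[/eqP + Bv].
rewrite -addrA !addr_eq0 opprD -(mulNmx x2) -(mulNmx x3) -(mulmxN D) -(mulmxN _ v3).
move=> /eqP xC /eqP xD /eqP Av.
rewrite (van _ _ _ _ _ _ _ _ xC xD xB Av Bv) !(mulNmx, mulmxN) !opprK.
by rewrite -addrA -opprD subrr.
Qed.

End HermitianSystem.

(** * Equivalence of solvability and the rank equalities *)

Theorem theorem3p7 (F : unitRingType) (divF : GRing.field_axiom F)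
    (charF : 2%N \notin [pchar F])
    (star : F -> F) (starP : involutive_antiautomorphism star)
    (m p q s t : nat)
    (A : 'M[F]_(m, p)) (B : 'M[F]_(m, q)) (C : 'M[F]_(s, p))
    (D : 'M[F]_(p, t)) (Phi : 'M[F]_m) (Omega : 'M[F]_(s, t))
    (PhiH : Phi = Phi ^t star) :
  (exists (X : 'M[F]_p) (Y : 'M[F]_(q, m)),
     [/\ A *m X *m A ^t star + B *m Y + (B *m Y) ^t star = Phi,
         C *m X *m D = Omega
       & X = X ^t star])
  <->
  (mxrank_div (col_mx (row_mx Phi          (row_mx A B))
                      (row_mx (B ^t star)  (row_mx 0 0)))
     = (mxrank_div (row_mx A B) + mxrank_div B)%N
   /\ mxrank_div (row_mx C Omega) = mxrank_div C
   /\ mxrank_div (col_mx D Omega) = mxrank_div D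
   /\ mxrank_div
        (col_mx (row_mx Phi         (row_mx 0        (row_mx A B)))
        (col_mx (row_mx 0           (row_mx (- Omega) (row_mx C 0)))
        (col_mx (row_mx (A ^t star) (row_mx D        (row_mx 0 0)))
                (row_mx (B ^t star) (row_mx 0        (row_mx 0 0))))))
      = (mxrank_div (col_mx (row_mx A B) (row_mx C 0))
         + mxrank_div (col_mx (row_mx A B) (row_mx (D ^t star) 0)))%N
   /\ mxrank_div
        (col_mx (row_mx Omega (row_mx 0                   C))
        (col_mx (row_mx 0     (row_mx (- (Omega ^t star)) (D ^t star)))
                (row_mx D     (row_mx (C ^t star)         0))))
      = (2 * mxrank_div (col_mx C (D ^t star)))%N
   /\ mxrank_div
        (col_mx (row_mx Phi (row_mx 0 (row_mx 0
                  (row_mx A (row_mx A B)))))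
        (col_mx (row_mx 0 (row_mx (- Omega) (row_mx 0
                  (row_mx C (row_mx 0 0)))))
        (col_mx (row_mx 0 (row_mx 0 (row_mx (- (Omega ^t star))
                  (row_mx 0 (row_mx (D ^t star) 0)))))
        (col_mx (row_mx (A ^t star) (row_mx D (row_mx (C ^t star)
                  (row_mx 0 (row_mx 0 0)))))
                (row_mx (B ^t star) (row_mx 0 (row_mx 0
                  (row_mx 0 (row_mx 0 0)))))))))
      = (mxrank_div (col_mx (row_mx A (row_mx A B))
                    (col_mx (row_mx C (row_mx 0 0))
                            (row_mx 0 (row_mx (D ^t star) 0))))
         + mxrank_div (col_mx (row_mx A B)
                      (col_mx (row_mx C 0)
                              (row_mx (D ^t star) 0))))%N).
Proof.
rewrite (rank_condition1P divF starP) (mxrank_div_rowP divF starP).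
rewrite (mxrank_div_colP divF starP) (rank_condition4P divF starP).
rewrite (rank_condition5P divF starP) (rank_condition6P divF starP).
split=> [[X [Y [EPhi EOm XH]]]|[c1 [c2 [c3 [c4 [c5 c6]]]]]]; last first.
  exact: (system_from_kernels divF charF starP PhiH).
(* Between a row killed by [B] and a column killed by [B ^t star] both terms in [Y] vanish, so each
   kernel condition compares values of the one form [X]. *)
have BYv k l (x : 'M_(k, m)) (v : 'M_(m, l)) : x *m B = 0 -> B ^t star *m v = 0 ->
    x *m Phi *m v = x *m A *m X *m (A ^t star *m v).
  move=> xB Bv; rewrite -EPhi (ctmxM starP) !mulmxDr !mulmxDl !mulmxA xB !mul0mx addr0.
  by rewrite -(mulmxA _ (B ^t star)) Bv mulmx0 addr0.
have OmS : Omega ^t star = D ^t star *m X *m C ^t star.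
  by rewrite -EOm !(ctmxM starP) -XH mulmxA.
split; [|split; [|split; [|split; [|split]]]].
- by move=> k l x v xA xB Bv; rewrite BYv // xA !mul0mx.
- by move=> k x xC; rewrite -EOm !mulmxA xC !mul0mx.
- by move=> k v Dv; rewrite -EOm -!mulmxA Dv !mulmx0.
- by move=> k l x1 x2 v1 v2 xA xB Av Bv; rewrite BYv // xA Av -EOm !mulmxA.
- move=> k l x1 x2 v1 v2 xC Dv.
  by rewrite OmS -EOm !mulmxA xC -!mulmxA Dv.
move=> k l x1 x2 x3 v1 v2 v3 xC xD xB Av Bv.
by rewrite BYv // Av mulmxDr {1}xC xD OmS -EOm !mulmxA.
Qed.
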